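(* Let $\mathcal H_1,\mathcal H_2$ be complex Hilbert spaces, $\Theta\subset\mathbb C$ open, $\Theta\ni z\mapsto T_z\in\mathcal C(\mathcal H_1,\mathcal H_2)$ a function with values in densely defined closed operators, and $z_0\in\Theta$. Then $z\mapsto T_z$ is complex differentiable at $z_0$ if there exists an open $\Theta_0$ with $z_0\in\Theta_0\subset\Theta$ such that for all $z\in\Theta_0$ the bounded operator $$\langle T_{z_0}\rangle^{-1}(1+T_{z_0}^*T_z)\langle T_z\rangle^{-1}$$ on $\mathcal H_1$ is invertible, so that one can define $$M_{T_z,T_{z_0}}=\begin{bmatrix}(1+T_{z_0}^*T_z)^{-1}&T_{z_0}^*(1+T_zT_{z_0}^* )^{-1}\\ T_z(1+T_{z_0}^*T_z)^{-1}&T_zT_{z_0}^*(1+T_zT_{z_0}^* )^{-1}\end{bmatrix}\in\mathcal B(\mathcal H_1\oplus\mathcal H_2),$$ and the function $\Theta_0\ni z\mapsto M_{T_z,T_{z_0}}$ is complex differentiable at $z_0$ (in operator norm).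
   Context: $\mathcal C(\mathcal H_1,\mathcal H_2)$ denotes closed operators from $\mathcal H_1$ to $\mathcal H_2$, $\mathcal B(\mathcal H)$ bounded everywhere defined operators on $\mathcal H$. For a densely defined closed $T$ put $\langle T\rangle=(1+T^*T)^{1/2}$ and $$J_T=\begin{bmatrix}\langle T\rangle^{-1}\\ T\langle T\rangle^{-1}\end{bmatrix}:\mathcal H_1\to\mathcal H_1\oplus\mathcal H_2,$$ which is bounded. The formal expression $\langle S\rangle^{-1}(1+S^*T)\langle T\rangle^{-1}$ means the bounded operator $J_S^*J_T$ on $\mathcal H_1$. When $J_S^*J_T$ is invertible (bijective with bounded inverse), the relative characteristic matrix is $M_{T,S}=J_T(J_S^*J_T)^{-1}J_S^*\in\mathcal B(\mathcal H_1\oplus\mathcal H_2)$; the formal block matrix in the claim is notation for $M_{T,S}$ with $T=T_z$, $S=T_{z_0}$, whose entries are understood as bounded everywhere defined operators. Complex differentiability of a closed-operator-valued function: $z\mapsto T_z\in\mathcal C(\mathcal H_1,\mathcal H_2)$ is complex differentiable at $z_0$ if there exist an open $\Theta_1$ with $z_0\in\Theta_1\subset\Theta$, a Banach space $\mathcal K$ and bounded injective operators with closed range $R_z:\mathcal K\to\mathcal H_1\oplus\mathcal H_2$, $z\in\Theta_1$, such that $R_z$ is a bijection of $\mathcal K$ onto the graph $\mathrm{Gr}(T_z)=\{(x,T_zx):x\in\mathrm{Dom}(T_z)\}$ for all $z\in\Theta_1$ and $z\mapsto R_z$ is complex differentiable at $z_0$ in operator norm. *)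

(* Defs.v *)
From HB Require Import structures.
From mathcomp Require Import all_boot all_order all_algebra.
From mathcomp Require Import complex.
From mathcomp Require Import ring.
From mathcomp Require Import all_classical all_reals all_analysis.

Set Implicit Arguments.
Unset Strict Implicit.
Unset Printing Implicit Defensive.

Import Order.TTheory GRing.Theory Num.Theory.
Import numFieldNormedType.Exports.

Local Open Scope classical_set_scope.
Local Open Scope ring_scope.

(* Typed as a [numClosedFieldType] so that the topology and the norm of a
   [numFieldType] are found on it.  Norms are nonnegative real elements of
   [C R], and [x <= y] in [C R] entails that [y - x] is real. *)
Definition C (R : realType) : numClosedFieldType := complex R.

(* The inner product is linear in its first argument, and conjugate linear in
   its second one. *)
HB.mixin Record isHilbert (R : realType) H & CompleteNormedModule (C R) H := {
  inner : {dot H for (Num.conj : C R -> C R)} ;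
  sqr_normr : forall x : H, `|x| ^+ 2 = inner x x
}.

#[short(type="hilbertType")]
HB.structure Definition Hilbert (R : realType) :=
  {H of isHilbert R H & CompleteNormedModule (C R) H}.

(* The Hilbert direct sum.  It is an alias of the product type because the
   library norm on the latter is the supremum norm. *)
Definition dsum (U V : Type) : Type := (U * V)%type.

Section DirectSum.
Context (R : realType) (U V : hilbertType R).

HB.instance Definition _ := GRing.Lmodule.copy (dsum U V) (U * V)%type.

Definition dsum_norm (x : dsum U V) : C R :=
  sqrtC (`|x.1| ^+ 2 + `|x.2| ^+ 2).

Let sq_ge0 (x : dsum U V) : 0 <= `|x.1| ^+ 2 + `|x.2| ^+ 2.
Proof. by rewrite addr_ge0// exprn_ge0. Qed.

Let dsum_norm_ge0 x : 0 <= dsum_norm x.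
Proof. by rewrite sqrtC_ge0. Qed.

Lemma dsum_normD (x y : dsum U V) :
  dsum_norm (x + y) <= dsum_norm x + dsum_norm y.
Proof.
set a := `|x.1|; set b := `|x.2|; set c := `|y.1|; set d := `|y.2|.
have [a0 b0 c0 d0] : [/\ 0 <= a, 0 <= b, 0 <= c & 0 <= d]
  by split; exact: normr_ge0.
have xE : dsum_norm x ^+ 2 = a ^+ 2 + b ^+ 2 by rewrite sqrtCK.
have yE : dsum_norm y ^+ 2 = c ^+ 2 + d ^+ 2 by rewrite sqrtCK.
have xy0 : 0 <= dsum_norm x * dsum_norm y by rewrite mulr_ge0.
have cs : a * c + b * d <= dsum_norm x * dsum_norm y.
  have acbd0 : 0 <= a * c + b * d by rewrite addr_ge0 ?mulr_ge0.
  rewrite -(@ler_pXn2r _ 2) ?nnegrE// exprMn xE yE -subr_ge0.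
  have -> : (a ^+ 2 + b ^+ 2) * (c ^+ 2 + d ^+ 2) - (a * c + b * d) ^+ 2
    = (a * d - b * c) ^+ 2 by ring.
  by rewrite real_exprn_even_ge0// rpredB// rpredM// ger0_real.
rewrite -(@ler_pXn2r _ 2) ?nnegrE ?addr_ge0// sqrtCK sqrrD xE yE.
apply: (@le_trans _ _ ((a + c) ^+ 2 + (b + d) ^+ 2)).
  by apply: lerD; rewrite ler_pXn2r ?nnegrE ?addr_ge0//; exact: ler_normD.
have -> : (a + c) ^+ 2 + (b + d) ^+ 2
  = (a ^+ 2 + b ^+ 2) + (a * c + b * d) *+ 2 + (c ^+ 2 + d ^+ 2) by ring.
by rewrite lerD2r lerD2l lerMn2r.
Qed.

Lemma dsum_normZ (l : C R) (x : dsum U V) :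
  dsum_norm (l *: x) = `|l| * dsum_norm x.
Proof.
rewrite /dsum_norm/= !normrZ !exprMn -mulrDr sqrtCM ?nnegrE ?exprn_ge0//.
by rewrite sqrCK.
Qed.

Lemma dsum_norm_eq0 (x : dsum U V) : dsum_norm x = 0 -> x = 0.
Proof.
move=> /eqP; rewrite sqrtC_eq0 paddr_eq0 ?exprn_ge0// !sqrf_eq0 !normr_eq0.
by case: x => a b /= /andP[/eqP-> /eqP->].
Qed.

HB.instance Definition _ := @Lmodule_isNormed.Build (C R) (dsum U V)
  dsum_norm dsum_normD dsum_normZ dsum_norm_eq0.

Let normE (x : dsum U V) : `|x| = dsum_norm x. Proof. by []. Qed.

Let norm_fst (x : dsum U V) : `|x.1| <= `|x|.
Proof.
rewrite normE -(@ler_pXn2r _ 2) ?nnegrE// ?dsum_norm_ge0// sqrtCK.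
by rewrite lerDl exprn_ge0.
Qed.

Let norm_snd (x : dsum U V) : `|x.2| <= `|x|.
Proof.
rewrite normE -(@ler_pXn2r _ 2) ?nnegrE// ?dsum_norm_ge0// sqrtCK.
by rewrite lerDr exprn_ge0.
Qed.

Let norm_le (x : dsum U V) : `|x| <= `|x.1| + `|x.2|.
Proof.
rewrite normE -(@ler_pXn2r _ 2) ?nnegrE// ?dsum_norm_ge0// ?addr_ge0// sqrtCK.
by rewrite sqrrD addrAC lerDl mulrn_wge0// mulr_ge0.
Qed.

Lemma dsum_complete (F : set_system (dsum U V)) :
  ProperFilter F -> cauchy F -> cvg F.
Proof.
move=> FF /cauchy_ballP Fc.
have c1 : cvg (fst @ F).
  apply: cauchy_cvg; apply/cauchy_ballP => e e0.
  have := Fc _ e0; rewrite !near_simpl => -[[A B]] [/= FA FB] AB.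
  exists (fst @` A, fst @` B).
    split => /=; rewrite /nbhs/=; [apply: filterS FA|apply: filterS FB].
      by move=> x Ax; exists x.
    by move=> x Ax; exists x.
  move=> [_ _] [[x Ax <-] [y By <-]]; have /= := AB (x, y) (conj Ax By).
  rewrite -!ball_normE /=; apply: le_lt_trans.
  by rewrite (_ : x.1 - y.1 = (x - y).1) ?norm_fst.
have c2 : cvg (snd @ F).
  apply: cauchy_cvg; apply/cauchy_ballP => e e0.
  have := Fc _ e0; rewrite !near_simpl => -[[A B]] [/= FA FB] AB.
  exists (snd @` A, snd @` B).
    split => /=; rewrite /nbhs/=; [apply: filterS FA|apply: filterS FB].
      by move=> x Ax; exists x.
    by move=> x Ax; exists x.
  move=> [_ _] [[x Ax <-] [y By <-]]; have /= := AB (x, y) (conj Ax By).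
  rewrite -!ball_normE /=; apply: le_lt_trans.
  by rewrite (_ : x.2 - y.2 = (x - y).2) ?norm_snd.
move: c1 c2 => /cvg_ex[a Fa] /cvg_ex[b Fb].
apply/cvg_ex; exists ((a, b) : dsum U V); apply/cvgrPdist_lt => e e0.
have e20 : 0 < e / 2 by rewrite divr_gt0.
move/cvgrPdist_lt: Fa => /(_ _ e20); move/cvgrPdist_lt: Fb => /(_ _ e20).
rewrite !near_simpl => Fb Fa; near=> x.
rewrite (le_lt_trans (norm_le _))// [ltRHS]splitr ltrD//=.
  by near: x.
by near: x.
Unshelve. all: by end_near. Qed.

HB.instance Definition _ := Uniform_isComplete.Build (dsum U V) dsum_complete.

Definition dsum_inner (x y : dsum U V) : C R :=
  inner x.1 y.1 + inner x.2 y.2.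

Lemma dsum_inner_bilinear :
  bilinear_for ( *%R : C R -> C R -> C R) (Num.conj \; *%R) dsum_inner.
Proof.
split => z a x y; rewrite /dsum_inner/=.
  by rewrite !linearPl/= mulrDr addrACA.
by rewrite !linearPr/= mulrDr addrACA.
Qed.

HB.instance Definition _ := @bilinear_isBilinear.Build (C R) (dsum U V)
  (dsum U V) (C R) _ _ dsum_inner dsum_inner_bilinear.

Lemma dsum_inner_hermitian (x y : dsum U V) :
  dsum_inner x y = (-1) ^+ false * (dsum_inner y x)^*.
Proof.
rewrite /dsum_inner/= expr0 mul1r rmorphD/=; congr +%R.
  by rewrite (@hermitian_subproof _ _ _ _ inner) expr0 mul1r.
by rewrite (@hermitian_subproof _ _ _ _ inner) expr0 mul1r.
Qed.

HB.instance Definition _ := @isHermitianSesquilinear.Build (C R) (dsum U V)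
  false Num.conj dsum_inner dsum_inner_hermitian.

Lemma dsum_sqr_normr (x : dsum U V) : `|x| ^+ 2 = dsum_inner x x.
Proof. by rewrite normE sqrtCK !sqr_normr. Qed.

Lemma dsum_inner_gt0 (x : dsum U V) : x != 0 -> 0 < dsum_inner x x.
Proof. by move=> x0; rewrite -dsum_sqr_normr exprn_gt0 ?normr_gt0. Qed.

HB.instance Definition _ := @isDotProduct.Build (C R) (dsum U V) dsum_inner
  dsum_inner_gt0.

HB.instance Definition _ := @isHilbert.Build R (dsum U V) dsum_inner
  dsum_sqr_normr.

End DirectSum.

(* A not necessarily everywhere defined operator; the values of the underlying
   total function outside [opdom] are irrelevant. *)
Record operator (R : realType) (H1 H2 : hilbertType R) := Operator {
  opdom : set H1 ;
  opfun :> H1 -> H2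
}.

Section Operators.
Context (R : realType).
Implicit Types H : hilbertType R.

Definition op_eq H1 H2 (A B : operator H1 H2) : Prop :=
  opdom A = opdom B /\ {in opdom A, A =1 B}.

Definition linear_operator H1 H2 (A : operator H1 H2) : Prop :=
  opdom A 0 /\
  forall (a : C R) (x y : H1), opdom A x -> opdom A y ->
    opdom A (a *: x + y) /\ A (a *: x + y) = a *: A x + A y.

Definition graph H1 H2 (A : operator H1 H2) : set (dsum H1 H2) :=
  [set p | opdom A p.1 /\ p.2 = A p.1].

Definition closed_operator H1 H2 (A : operator H1 H2) : Prop :=
  linear_operator A /\ closed (graph A).

Definition densely_defined H1 H2 (A : operator H1 H2) : Prop :=
  dense (opdom A).

Definition op_id H : operator H H := Operator setT id.

Definition op_add H1 H2 (A B : operator H1 H2) : operator H1 H2 :=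
  Operator (opdom A `&` opdom B) (fun x => A x + B x).

Definition op_comp H1 H2 H3 (A : operator H2 H3) (B : operator H1 H2) :
    operator H1 H3 :=
  Operator [set x | opdom B x /\ opdom A (B x)] (fun x => A (B x)).

Definition op_inv H1 H2 (A : operator H1 H2) : operator H2 H1 :=
  Operator (A @` opdom A) (fun y => get [set x | opdom A x /\ A x = y]).

Definition adjoint_at H1 H2 (A : operator H1 H2) (y : H2) : set H1 :=
  [set w | forall x, opdom A x -> inner (A x) y = inner x w].

(* If [A] is densely defined, [adjoint_at A y] has at most one element. *)
Definition adjoint H1 H2 (A : operator H1 H2) : operator H2 H1 :=
  Operator [set y | adjoint_at A y !=set0] (fun y => get (adjoint_at A y)).

(* The operator with the two blocks [A] and [B] stacked in a column. *)
Definition op_col H1 H2 H3 (A : operator H1 H2) (B : operator H1 H3) :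
    operator H1 (dsum H2 H3) :=
  Operator (opdom A `&` opdom B) (fun x => (A x, B x) : dsum H2 H3).

Definition self_adjoint H (A : operator H H) : Prop :=
  [/\ linear_operator A, densely_defined A & op_eq A (adjoint A)].

Definition nonnegative H (A : operator H H) : Prop :=
  forall x, opdom A x -> 0 <= inner (A x) x.

Definition is_op_sqrt H (A Q : operator H H) : Prop :=
  [/\ self_adjoint Q, nonnegative Q & op_eq (op_comp Q Q) A].

(* A nonnegative self-adjoint operator has a square root, unique up to
   [op_eq]; the fallback value [A] is then not used. *)
Definition op_sqrt H (A : operator H H) : operator H H :=
  if pselect (exists Q, is_op_sqrt A Q) is left ex then projT1 (cid ex) else A.

(* <T> = (1 + T^* T)^(1/2). *)
Definition bracket H1 H2 (T : operator H1 H2) : operator H1 H1 :=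
  op_sqrt (op_add (op_id H1) (op_comp (adjoint T) T)).

Definition J H1 H2 (T : operator H1 H2) : operator H1 (dsum H1 H2) :=
  op_col (op_inv (bracket T)) (op_comp T (op_inv (bracket T))).

(* The bounded operator formally written <S>^-1 (1 + S^* T) <T>^-1. *)
Definition JJ H1 H2 (S T : operator H1 H2) : operator H1 H1 :=
  op_comp (adjoint (J S)) (J T).

(* The relative characteristic matrix J_T (J_S^* J_T)^-1 J_S^*, whose blocks are
   formally (1 + S^* T)^-1, S^* (1 + T S^* )^-1, T (1 + S^* T)^-1 and
   T S^* (1 + T S^* )^-1. *)
Definition charmx H1 H2 (T S : operator H1 H2) :
    operator (dsum H1 H2) (dsum H1 H2) :=
  op_comp (J T) (op_comp (op_inv (JJ S T)) (adjoint (J S))).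

Definition bounded_linear (V W : normedModType (C R)) (f : V -> W) : Prop :=
  linear f /\ exists M : C R, forall x, `|f x| <= M * `|x|.

Definition bounded_operator H1 H2 (A : operator H1 H2) : Prop :=
  opdom A = setT /\ bounded_linear A.

Definition op_invertible H (A : operator H H) : Prop :=
  set_bij (opdom A) setT A /\ bounded_operator (op_inv A).

(* The difference quotient converges to [D] in operator norm. *)
Definition norm_differentiable_at (V W : normedModType (C R))
    (A : C R -> V -> W) (z0 : C R) : Prop :=
  exists2 D : V -> W, bounded_linear D &
    forall e : C R, 0 < e -> \forall z \near z0^', forall x : V,
      `|(z - z0)^-1 *: (A z x - A z0 x) - D x| <= e * `|x|.

Definition complex_differentiable_at H1 H2 (Theta : set (C R))
    (T : C R -> operator H1 H2) (z0 : C R) : Prop :=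
  exists Theta1 : set (C R),
    [/\ open Theta1, Theta1 z0, Theta1 `<=` Theta &
     exists (K : completeNormedModType (C R)) (Rz : C R -> K -> dsum H1 H2),
       (forall z, Theta1 z ->
         [/\ bounded_linear (Rz z), injective (Rz z), closed (range (Rz z)) &
             set_bij setT (graph (T z)) (Rz z)]) /\
       norm_differentiable_at Rz z0].

End Operators.

(* Main.v *)
(* With J_z := J_(T_z), the family R_z := J_z (J_(z0)^* J_z)^-1 on K := H1 is
   M_(T_z, T_z0) composed with the fixed bounded map R_(z0), because
   J_(z0)^* R_(z0) = 1; hence it is differentiable at z0 when the relative
   characteristic matrix is.  That R_z is onto the graph of T_z comes from
   J_z being bounded below, as J_(z0)^* J_z is: its range is then closed, and
   it contains the graph of the restriction of T_z to the domain of
   1 + T_z^* T_z, which is dense in the graph of T_z. *)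
Require Import Defs.
From mathcomp Require Import all_boot all_order all_algebra.
From mathcomp Require Import complex ring.
From mathcomp Require Import all_classical all_reals all_analysis.

Set Implicit Arguments.
Unset Strict Implicit.

Import Order.TTheory GRing.Theory Num.Theory.
Import numFieldNormedType.Exports.

Local Open Scope classical_set_scope.
Local Open Scope ring_scope.

(** * Infima, density and completeness in terms of the norm *)

(** Nonnegative elements of [C R] are real, so the infimum can be taken over the corresponding set
    of reals, which [0] bounds below. *)
Lemma nneg_inf (R : realType) (A : set (C R)) :
  A !=set0 -> (forall a, A a -> 0 <= a) ->
  exists d : C R, (forall a, A a -> d <= a) /\
    forall e, 0 < e -> exists2 a, A a & a < d + e.
Proof.
move=> [a0 Aa0] A0; pose E : set R := [set r | A (r%:C)%C].
have AE a : A a -> exists2 r, E r & a = (r%:C)%C.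
  case: a => [r i] Aa; have := A0 _ Aa; rewrite lecE /= => /andP[/eqP i0 _].
  by exists r; rewrite /E /= i0 in Aa *.
have Einf : has_inf E.
  split; first by have [r Er _] := AE _ Aa0; exists r.
  by exists 0 => r /A0; rewrite lecR.
exists (inf E)%:C%C; split => [a /AE[r Er ->]|[e i]].
  by rewrite lecR; apply: ge_inf => //; case: Einf.
rewrite ltcE/= => /andP[/eqP-> e0].
have [r Er re] := inf_adherent e0 Einf.
by exists r%:C%C => //; rewrite ltcE/= addr0 eqxx.
Qed.

(** A positive [x] would violate the bound at [e := x / (c + 1)]. The factor [c] collects the fixed
    norms of an estimate. *)
Lemma eq0_le_small (R : realType) (x c : C R) : 0 <= x -> 0 <= c ->
  (forall e, 0 < e -> x <= e * c) -> x = 0.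
Proof.
move=> x0 c0 xc; apply/eqP; apply: contraT => xn0.
have xp : 0 < x by rewrite lt_def xn0.
have cp : 0 < c + 1 by rewrite ltr_wpDl.
have := xc _ (divr_gt0 xp cp).
by rewrite mulrAC ler_pdivlMr// mulrDr mulr1 gerDl lt_geF.
Qed.

Lemma closure_normP (R : realType) (V : normedModType (C R)) (S : set V) p :
  closure S p <-> forall e : C R, 0 < e -> exists2 s, S s & `|p - s| < e.
Proof.
split => [Sp e e0|Sp B /nbhs_ballP[e /= e0 eB]].
  have [s [Ss]] := Sp _ (nbhsx_ballx p e e0).
  by rewrite -ball_normE; exists s.
have [s Ss ps] := Sp _ e0; exists s; split => //; apply: eB.
by rewrite -ball_normE.
Qed.

Lemma dense_norm (R : realType) (V : normedModType (C R)) (S : set V) p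
    (e : C R) :
  dense S -> 0 < e -> exists2 s, S s & `|p - s| < e.
Proof.
move=> Sd e0; have [||s [ps Ss]] := Sd (ball p e).
- by exists p; exact: ballxx.
- exact: ball_open.
- by exists s => //; rewrite -ball_normE in ps.
Qed.

(* Completeness, for a Cauchy filter base [B] indexed by the positive [e]. *)
Lemma complete_approx (R : realType) (V : completeNormedModType (C R))
    (B : C R -> set V) :
  (forall e, 0 < e -> B e !=set0) ->
  (forall e e', e <= e' -> B e `<=` B e') ->
  (forall e, 0 < e ->
    exists2 k, 0 < k & forall s t, B k s -> B k t -> `|s - t| < e) ->
  exists p, forall e, 0 < e -> exists2 s, B e s & `|p - s| < e.
Proof.
move=> B0 Bmono Bc.
pose F := filter_from [set e : C R | 0 < e] B.
have FF : ProperFilter F.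
  apply: filter_from_proper => //.
  apply: filter_from_filter; first by exists 1; rewrite /= ltr01.
  move=> i j /= i0 j0.
  have /orP[ij|ij] := real_leVge (gtr0_real i0) (gtr0_real j0).
    by exists i => // s Bs; split => //; exact: Bmono Bs.
  by exists j => // s Bs; split => //; exact: Bmono Bs.
have Fc : cauchy F.
  apply/cauchy_ballP => e e0; have [k k0 Bk] := Bc _ e0.
  exists (B k, B k); first by split; exists k.
  by move=> [s t] /= [Bs Bt]; rewrite -ball_normE /=; exact: Bk.
have /cvg_ex[p Fp] : cvg F by exact: cauchy_cvg.
exists p => e e0.
have FB : F (B e) by exists e.
have Fe : F (ball p e) by apply: Fp; exact: nbhsx_ballx.
have [s [Bs ps]] := @filter_ex _ _ FF _ (@filterI _ _ FF _ _ FB Fe).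
by exists s => //; rewrite -ball_normE in ps.
Qed.

(** * Hilbert space geometry, up to orthogonal projection and Riesz representation *)

Section HilbertSpace.
Context (R : realType) (H : hilbertType R).
Implicit Types (x y z : H) (a : C R) (S : set H).

Lemma innerDl x y z : inner (x + y) z = inner x z + inner y z.
Proof. exact: linearDl. Qed.

Lemma innerDr x y z : inner z (x + y) = inner z x + inner z y.
Proof. exact: linearDr. Qed.

Lemma innerBl x y z : inner (x - y) z = inner x z - inner y z.
Proof. exact: linearBl. Qed.

Lemma innerBr x y z : inner z (x - y) = inner z x - inner z y.
Proof. exact: linearBr. Qed.

Lemma innerZl a x y : inner (a *: x) y = a * inner x y.
Proof. exact: linearZl_LR. Qed.

Lemma innerZr a x y : inner x (a *: y) = a^* * inner x y.
Proof. exact: linearZr_LR. Qed.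

Lemma inner_conj x y : (inner x y)^* = inner y x.
Proof. by rewrite [RHS]hermC expr0 mul1r. Qed.

Lemma eq0_innerl x : (forall y, inner x y = 0) -> x = 0.
Proof.
move=> /(_ x) /eqP; rewrite -sqr_normr expf_eq0/= normr_eq0.
exact: eqP.
Qed.

Lemma sqr_normrB x y :
  `|x - y| ^+ 2 = `|x| ^+ 2 - (inner x y + (inner x y)^* ) + `|y| ^+ 2.
Proof.
by rewrite !sqr_normr innerBl !innerBr inner_conj; ring.
Qed.

Lemma parallelogram x y :
  `|x - y| ^+ 2 = 2 * `|x| ^+ 2 + 2 * `|y| ^+ 2 - `|x + y| ^+ 2.
Proof.
by rewrite !sqr_normr innerBl !innerBr !innerDl !innerDr; ring.
Qed.

(** Pythagoras: the vector on the left is what remains of [x] after its orthogonal projection onto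
    the line through [y] is removed. *)
Lemma sqr_norm_residual x y : y != 0 ->
  `|x - (inner x y / `|y| ^+ 2) *: y| ^+ 2 =
  `|x| ^+ 2 - `|inner x y| ^+ 2 / `|y| ^+ 2.
Proof.
move=> y0.
have yn : `|y| ^+ 2 != 0 by rewrite expf_eq0/= normr_eq0.
have yc : (`|y| ^+ 2)^* = `|y| ^+ 2 by rewrite geC0_conj// exprn_ge0.
set a := _ / _.
have ac : a^* = (inner x y)^* / `|y| ^+ 2 by rewrite rmorphM fmorphV/= yc.
rewrite sqr_normrB normrZ exprMn !normCK innerZr [(a^* * _)^*]rmorphM/= conjCK.
by rewrite ac /a; set Y := `|y| ^+ 2 in yn *; field.
Qed.

Lemma cauchy_schwarz x y : `|inner x y| <= `|x| * `|y|.
Proof.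
have [->|y0] := eqVneq y 0.
  by rewrite -(scale0r (0 : H)) innerZr conjC0 mul0r normr0 mulr_ge0.
have yp : 0 < `|y| ^+ 2 by rewrite exprn_gt0// normr_gt0.
rewrite -(@ler_pXn2r _ 2) ?nnegrE ?mulr_ge0// exprMn -ler_pdivrMr//.
by rewrite -subr_ge0 -sqr_norm_residual// exprn_ge0.
Qed.

Definition linear_subspace S : Prop :=
  S 0 /\ forall a x y, S x -> S y -> S (a *: x + y).

Lemma subspaceZ S a x : linear_subspace S -> S x -> S (a *: x).
Proof. by move=> [S0 SP] Sx; rewrite -[_ *: _]addr0; apply: SP. Qed.

Lemma subspaceD S x y : linear_subspace S -> S x -> S y -> S (x + y).
Proof. by move=> [_ SP] Sx Sy; rewrite -[x]scale1r; apply: SP. Qed.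

Lemma subspaceB S x y : linear_subspace S -> S x -> S y -> S (x - y).
Proof.
move=> SS Sx Sy; rewrite -scaleN1r; apply: subspaceD => //.
exact: subspaceZ.
Qed.

(** Near minimisers of the distance from [h] to [S] are close to each other by the parallelogram
    law, and [p] is their limit. Orthogonality is proved approximately at a near minimiser and
    carried over to [p]. *)
Lemma projection S h : linear_subspace S -> closed S ->
  exists2 p, S p & forall s, S s -> inner (h - p) s = 0.
Proof.
move=> SS Scl; have [S0 _] := SS.
pose A := [set `|h - s| ^+ 2 | s in S].
have A0 a : A a -> 0 <= a by move=> [s _ <-]; rewrite exprn_ge0.
have [||d [dA Ad]] := @nneg_inf R A; first by exists (`|h - 0| ^+ 2), 0.
  exact: A0.
have dS s : S s -> d <= `|h - s| ^+ 2 by move=> Ss; apply: dA; exists s.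
pose B (e : C R) := [set s | S s /\ `|h - s| ^+ 2 < d + e].
have near_dist s t k : B k s -> B k t -> `|s - t| ^+ 2 < 4 * k.
  move=> [Ss sk] [St tk].
  have -> : s - t = (h - t) - (h - s) by rewrite opprB [RHS]addrC subrKA.
  rewrite parallelogram.
  have -> : h - t + (h - s) = 2 *: (h - 2^-1 *: (s + t)).
    rewrite scalerBr scalerA divff ?pnatr_eq0// scale1r addrACA -mulr2n.
    by rewrite scaler_nat -opprD [t + s]addrC.
  rewrite normrZ exprMn.
  (* The midpoint of [s] and [t] lies in [S], so its squared distance to [h] is at least [d]. *)
  have := dS (2^-1 *: (s + t)).
  move=> /(_ (subspaceZ _ SS (subspaceD SS Ss St))).
  set u := `|h - _ *: _| ^+ 2 => du.
  rewrite ger0_norm// ltrBlDr.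
  apply: (@lt_le_trans _ _ (2 * (d + k) + 2 * (d + k))).
    by apply: ltrD; rewrite ltr_pM2l.
  have -> : 2 * (d + k) + 2 * (d + k) = 4 * k + 2 ^+ 2 * d by ring.
  by rewrite lerD2l ler_pM2l// exprn_gt0.
have [||e e0|p Bp] := @complete_approx _ _ B.
- by move=> e /Ad[_ [s Ss <-] se]; exists s.
- by move=> e e' ee' s [Ss se]; split=> //; rewrite (lt_le_trans se)// lerD2l.
- have k0 : 0 < e ^+ 2 / 4 by rewrite divr_gt0// exprn_gt0.
  exists (e ^+ 2 / 4) => // s t Bs Bt.
  rewrite -(@ltr_pXn2r _ 2) ?nnegrE ?(ltW e0)//.
  by rewrite (lt_le_trans (near_dist _ _ _ Bs Bt))// mulrC divfK.
exists p => [|t St].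
  by apply: Scl; apply/closure_normP => e /Bp[s [Ss _] ps]; exists s.
have [->|t0] := eqVneq t 0.
  by rewrite -(scale0r (0 : H)) innerZr conjC0 mul0r.
apply/eqP; rewrite -normr_eq0; apply/eqP.
apply: (@eq0_le_small _ _ (`|t| + `|t|)) => // e e0.
(* The smaller of [e] and [e ^+ 2]: the first bounds [|p - s|], the second the excess of
   [|h - s| ^+ 2] over [d]. *)
pose k := if e ^+ 2 <= e then e ^+ 2 else e.
have k0 : 0 < k by rewrite /k; case: ifP; rewrite ?exprn_gt0.
have e20 : 0 < e ^+ 2 by rewrite exprn_gt0.
have ke : k <= e /\ k <= e ^+ 2.
  rewrite /k; have /orP[ee|ee] := real_leVge (gtr0_real e0) (gtr0_real e20).
    by case: ifP.
  by rewrite ee.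
have [s [Ss sd] se] := Bp _ k0.
have tp : 0 < `|t| ^+ 2 by rewrite exprn_gt0// normr_gt0.
(* Removing from [h - s] its component along [t] amounts to moving [s] within [S], so the squared
   norm stays at least [d] and the component is small. *)
have st : `|inner (h - s) t| <= e * `|t|.
  rewrite -(@ler_pXn2r _ 2) ?nnegrE ?mulr_ge0 ?(ltW e0)// exprMn -ler_pdivrMr//.
  rewrite -[X in X <= _](subKr (`|h - s| ^+ 2)) -sqr_norm_residual// lerBlDr.
  rewrite (le_trans (ltW sd))// addrC lerD ?ke.2// -addrA -opprD dS//.
  by apply: subspaceD => //; exact: subspaceZ.
have -> : h - p = (h - s) - (p - s) by rewrite opprB addrA subrK.
rewrite innerBl (le_trans (ler_normB _ _))// mulrDr lerD//.
rewrite (le_trans (cauchy_schwarz _ _))// ler_wpM2r//.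
by rewrite (le_trans (ltW se)) ?ke.1.
Qed.

(** Unless [f] is zero, the part [v] of some [x0] orthogonal to the kernel [N] is nonzero, and a
    multiple of it represents [f]. The scalar is conjugated because [inner] is conjugate linear on
    the right. *)
Lemma riesz (f : H -> C R) (M : C R) :
  (forall a x y, f (a *: x + y) = a * f x + f y) ->
  (forall x, `|f x| <= M * `|x|) -> 0 <= M ->
  exists w, forall x, f x = inner x w.
Proof.
move=> flin fM M0.
have f0 : f 0 = 0.
  by have := flin (-1) 0 0; rewrite scaler0 addr0 mulN1r addNr.
have fD x y : f (x + y) = f x + f y.
  by rewrite -[in LHS](scale1r x) flin mul1r.
have fZ a x : f (a *: x) = a * f x by rewrite -[_ *: _]addr0 flin f0 addr0.
pose N := [set x | f x = 0].
have Nsub : linear_subspace N.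
  by split=> // a x y; rewrite /N/= flin => -> ->; rewrite mulr0 addr0.
have Ncl : closed N.
  move=> p /closure_normP Np; apply/eqP; rewrite -normr_eq0; apply/eqP.
  apply: (@eq0_le_small _ _ M) => // e /Np[s Ns ps].
  rewrite -[p](subrK s) fD Ns addr0 (le_trans (fM _))// mulrC ler_wpM2r//.
  exact: ltW.
have [N1|] := pselect (forall x, f x = 0).
  by exists 0 => x; rewrite -(scale0r (0 : H)) innerZr conjC0 mul0r.
move=> /existsNP[x0 fx0].
have [p Np xp] := projection x0 Nsub Ncl.
set v := x0 - p in xp.
have fv : f v = f x0 by rewrite /v -scaleN1r addrC flin Np mulr0 add0r.
have fv0 : f v != 0 by rewrite fv; apply/eqP.
have v0 : inner v v != 0.
  rewrite -sqr_normr expf_eq0/= normr_eq0; apply: contra_neq fv0 => ->.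
  exact: f0.
exists ((f v / inner v v)^* *: v) => x.
rewrite innerZr conjCK.
(* Subtracting a suitable multiple of [v] brings any [x] into [N], which is orthogonal to [v]. *)
have : N (x - (f x / f v) *: v).
  by rewrite /N/= -scaleNr fD fZ mulNr divfK// subrr.
move=> /xp; rewrite innerBr innerZr => /eqP; rewrite subr_eq0 => /eqP vx.
rewrite -(inner_conj v x) vx rmorphM/= conjCK inner_conj.
by field; rewrite v0 fv0.
Qed.

End HilbertSpace.

Lemma sqr_normr_eq0 (R : realType) (H : hilbertType R) (x : H) :
  `|x| ^+ 2 = 0 -> x = 0.
Proof. by move=> /eqP; rewrite expf_eq0/= normr_eq0 => /eqP. Qed.

(** If [s] in [S] is close to [u], then [|u| ^+ 2 = inner (u - s) u] is small. *)
Lemma dense_inner_eq0 (R : realType) (H : hilbertType R) (S : set H) u :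
  dense S -> (forall x, S x -> inner x u = 0) -> u = 0.
Proof.
move=> Sd Su; apply: sqr_normr_eq0.
apply: (@eq0_le_small _ _ `|u|) => // e e0.
have [s Ss us] := dense_norm u Sd e0.
rewrite -[X in X <= _]ger0_norm ?exprn_ge0// sqr_normr.
rewrite -[X in inner X _](subrK s) innerDl (Su _ Ss) addr0.
by rewrite (le_trans (cauchy_schwarz _ _))// ler_wpM2r// ltW.
Qed.

(** * Linear operators, their graphs and adjoints *)

Section LinearOperator.
Context (R : realType) (H1 H2 : hilbertType R) (A : operator H1 H2).
Context (linA : linear_operator A).

Lemma linear_operatorP a x y : opdom A x -> opdom A y ->
  A (a *: x + y) = a *: A x + A y.
Proof. by move=> Ax Ay; have [_ /(_ a x y Ax Ay)[]] := linA. Qed.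

Lemma subspace_opdom : linear_subspace (opdom A).
Proof.
have [A0 AP] := linA; split => // a x y Ax Ay.
by have [] := AP a _ _ Ax Ay.
Qed.

Lemma linear_operatorB x y : opdom A x -> opdom A y -> A (x - y) = A x - A y.
Proof.
by move=> Ax Ay; rewrite addrC -scaleN1r linear_operatorP// scaleN1r addrC.
Qed.

Lemma linear_operator0 : A 0 = 0.
Proof.
have [A0 _] := linA.
by rewrite -[X in A X](subrr 0) linear_operatorB// subrr.
Qed.

Lemma subspace_graph : linear_subspace (graph A).
Proof.
have [A0 AP] := linA; split; first by split => //=; rewrite linear_operator0.
move=> a [x1 x2] [y1 y2] [/= Ax ->] [/= Ay ->].
by have [] := AP a _ _ Ax Ay; split.
Qed.

End LinearOperator.

Lemma adjointP (R : realType) (H1 H2 : hilbertType R) (A : operator H1 H2) x y :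
  opdom A x -> opdom (adjoint A) y -> inner (A x) y = inner x (adjoint A y).
Proof. by move=> Ax Ay; have /= := getPex Ay; apply. Qed.

(** Two candidate values differ by a vector orthogonal to the dense domain. *)
Lemma adjoint_eq (R : realType) (H1 H2 : hilbertType R) (A : operator H1 H2)
    y w :
  densely_defined A -> adjoint_at A y w -> adjoint A y = w.
Proof.
move=> Ad Aw; apply/eqP; rewrite -subr_eq0; apply/eqP.
apply: (dense_inner_eq0 Ad) => x Ax.
by rewrite innerBr -adjointP ?Aw ?subrr//; exists w.
Qed.

(** * The operator [1 + T^* T] *)

Section BracketSquare.
Context (R : realType) (H1 H2 : hilbertType R) (T : operator H1 H2).
Context (closedT : closed_operator T) (denseT : densely_defined T).

Local Notation A := (op_add (op_id H1) (op_comp (adjoint T) T)).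

Let linT : linear_operator T := closedT.1.

Lemma bracket_squareE x : A x = x + adjoint T (T x).
Proof. by []. Qed.

Lemma opdom_bracket_square x : opdom A x -> opdom T x.
Proof. by case=> _ []. Qed.

Lemma inner_bracket_square x y : opdom A x -> opdom T y ->
  inner (A x) y = inner x y + inner (T x) (T y).
Proof.
move=> [_ [Tx TTx]] Ty; rewrite bracket_squareE innerDl; congr (_ + _).
by rewrite -inner_conj -adjointP// inner_conj.
Qed.

Lemma sqr_norm_bracket_square x : opdom A x ->
  inner (A x) x = `|x| ^+ 2 + `|T x| ^+ 2.
Proof.
move=> Ax; rewrite inner_bracket_square ?sqr_normr//.
exact: opdom_bracket_square.
Qed.

Lemma linear_bracket_square : linear_operator A.
Proof.
split.
  split => //; split; first by have [] := linT.
  by exists 0 => x _ /=; rewrite linear_operator0// -(scale0r (0 : H2))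
    -(scale0r (0 : H1)) !innerZr conjC0 !mul0r.
move=> a x y [_ [Tx TTx]] [_ [Ty TTy]].
have TTxy : adjoint_at T (T (a *: x + y))
    (a *: adjoint T (T x) + adjoint T (T y)).
  move=> z Tz; rewrite linear_operatorP// !innerDr !innerZr.
  by rewrite (adjointP Tz TTx) (adjointP Tz TTy).
split.
  split => //; split; last by exists (a *: adjoint T (T x) + adjoint T (T y)).
  exact: (subspace_opdom linT).2.
by rewrite !bracket_squareE (adjoint_eq denseT TTxy) scalerDr addrACA.
Qed.

(** Projecting [(h, 0)] onto the closed graph of [T] gives [(x, T x)]; orthogonality of
    [(h - x, - T x)] to the graph says exactly that [T^* T x = h - x]. *)
Lemma bracket_square_surj h : exists2 x, opdom A x & A x = h.
Proof.
have [[x y] [/= Tx ->] xh] :=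
  projection ((h, 0) : dsum H1 H2) (subspace_graph linT) closedT.2.
have TTx : adjoint_at T (T x) (h - x).
  move=> a Ta.
  have : inner (h - x) a + inner (0 - T x) (T a) = 0.
    exact: (xh ((a, T a) : dsum H1 H2) (conj Ta erefl)).
  rewrite [inner (0 - _) _]innerBl [inner 0 _]linear0l sub0r => /eqP.
  rewrite subr_eq0 => /eqP hx.
  by rewrite -(inner_conj (T x)) -hx inner_conj.
exists x; first by split => //; split => //; exists (h - x).
rewrite -[LHS]/(x + adjoint T (T x)).
by rewrite (adjoint_eq denseT TTx) addrC subrK.
Qed.

(* The domain of [1 + T^* T] is a core of [T]. *)
Lemma bracket_square_core (p : dsum H1 H2) : graph T p ->
  (forall x, opdom A x -> inner p ((x, T x) : dsum H1 H2) = 0) -> p = 0.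
Proof.
case: p => x y [/= Tx ->] xA; have [a Aa ax] := bracket_square_surj x.
suff x0 : x = 0 by rewrite x0 linear_operator0.
(* Since [(1 + T^* T) a = x], the number [inner x x] is, up to conjugation, the inner product of [p]
   with [(a, T a)]. *)
apply: sqr_normr_eq0; rewrite sqr_normr -{1}ax.
rewrite inner_bracket_square// -(inner_conj x _) -(inner_conj (T x) _) -rmorphD.
rewrite (xA _ Aa : inner x a + inner (T x) (T a) = 0).
exact: rmorph0.
Qed.

End BracketSquare.

(* What is used of the bracket of [T].  Both a square root of [1 + T^* T] and
   [1 + T^* T] itself, the fallback value of [op_sqrt], have these properties,
   so that the existence of square roots is not needed. *)
Definition bracket_like (R : realType) (H1 H2 : hilbertType R)
    (T : operator H1 H2) (Q : operator H1 H1) : Prop :=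
  [/\ linear_operator Q,
      opdom (op_add (op_id H1) (op_comp (adjoint T) T)) `<=` opdom Q,
      forall h, exists2 x, opdom Q x & Q x = h &
      forall x, opdom Q x ->
        opdom T x /\ `|x| ^+ 2 + `|T x| ^+ 2 <= `|Q x| ^+ 2].

(** * Norm bounds for the bracket *)

Section BracketLike.
Context (R : realType) (H1 H2 : hilbertType R) (T : operator H1 H2).
Context (closedT : closed_operator T) (denseT : densely_defined T).

Local Notation A := (op_add (op_id H1) (op_comp (adjoint T) T)).

Let linT : linear_operator T := closedT.1.

Lemma sqr_norm_dsum (x : H1) (y : H2) :
  `|(x, y) : dsum H1 H2| ^+ 2 = `|x| ^+ 2 + `|y| ^+ 2.
Proof. by rewrite !sqr_normr. Qed.

Lemma norm_fst_le (p : dsum H1 H2) : `|p.1| <= `|p|.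
Proof.
case: p => x y; rewrite -(@ler_pXn2r _ 2) ?nnegrE// sqr_norm_dsum lerDl.
exact: exprn_ge0.
Qed.

(** Cauchy-Schwarz bounds [|x| ^+ 2 + |T x| ^+ 2 = inner (A x) x] by [|A x| * |x|]; this first gives
    [|x| <= |A x|], which then replaces the second factor. *)
Lemma bracket_like_square : bracket_like T A.
Proof.
split => //; first exact: linear_bracket_square.
  exact: bracket_square_surj.
move=> x Ax; split; first exact: opdom_bracket_square Ax.
have sq : `|x| ^+ 2 + `|T x| ^+ 2 <= `|A x| * `|x|.
  rewrite -sqr_norm_bracket_square// (le_trans _ (cauchy_schwarz _ _))//.
  apply: real_ler_norm; apply: ger0_real.
  by rewrite sqr_norm_bracket_square// addr_ge0 ?exprn_ge0.
have xA : `|x| <= `|A x|.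
  have [->|x0] := eqVneq x 0; first by rewrite normr0.
  rewrite -(@ler_pM2r _ `|x|) ?normr_gt0// -expr2 (le_trans _ sq)//.
  by rewrite lerDl exprn_ge0.
by rewrite (le_trans sq)// expr2 ler_wpM2l.
Qed.

(** Symmetry of [Q] gives [|(a, T a)| = |Q a|] on the domain of [A]. For general [x], points [a] of
    that domain with [Q a] close to [Q x] yield a Cauchy family in the graph of [T]. Its limit [p]
    is [(x, T x)], and the norm bound passes to the limit. *)
Lemma bracket_like_sqrt Q : is_op_sqrt A Q -> bracket_like T Q.
Proof.
move=> [[linQ denseQ [domQ eqQ]] _ [domQQ eqQQ]].
have QQA x : opdom A x -> opdom Q x /\ opdom Q (Q x) by rewrite -domQQ.
have QQE x : opdom A x -> Q (Q x) = A x.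
  by move=> Ax; apply: eqQQ; rewrite inE domQQ.
have symQ x y : opdom Q x -> opdom Q y -> inner (Q x) y = inner x (Q y).
  move=> Qx Qy; rewrite (eqQ y) ?inE//; apply: adjointP => //.
  by rewrite -domQ.
have surjQ h : exists2 x, opdom Q x & Q x = h.
  have [x Ax xh] := bracket_square_surj closedT denseT h.
  by exists (Q x); [case: (QQA _ Ax)|rewrite QQE].
have normQ x : opdom A x -> `|(x, T x) : dsum H1 H2| = `|Q x|.
  move=> Ax; have [Qx QQx] := QQA _ Ax.
  apply/eqP; rewrite -(@eqrXn2 _ 2)//; apply/eqP.
  rewrite sqr_norm_dsum -sqr_norm_bracket_square//.
  by rewrite -QQE// sqr_normr symQ.
have subA := subspace_opdom (linear_bracket_square closedT denseT).
split => //; first by move=> x /QQA[].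
move=> x Qx.
pose B (e : C R) := [set p : dsum H1 H2 |
  exists2 a, opdom A a & p = (a, T a) /\ `|Q x - Q a| < e].
have [e e0|e e' ee'|e e0|p Bp] := @complete_approx R (dsum H1 H2) B.
(* A preimage [a] of a point [y] in the domain of [Q] has [Q (Q a)] defined, hence lies in the
   domain of [A]. *)
- have [y Qy xy] := dense_norm (Q x) denseQ e0.
  have [a Qa ay] := surjQ y.
  have Aa : opdom A a by rewrite -domQQ; split; rewrite ?ay.
  by exists (a, T a), a; rewrite ?ay.
- by move=> _ [a Aa [-> ae]]; exists a; rewrite ?(lt_le_trans ae).
- exists (e / 2); first by rewrite divr_gt0.
  move=> _ _ [a Aa [-> ae]] [b Ab [-> be]].
  have [[Qa _] [Qb _]] := (QQA _ Aa, QQA _ Ab).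
  have -> : ((a, T a) - (b, T b) : dsum H1 H2) = (a - b, T (a - b)).
    by rewrite linear_operatorB//; exact: opdom_bracket_square.
  rewrite normQ; last exact: subspaceB.
  rewrite linear_operatorB// -(subrKA (Q x)) [e]splitr.
  by rewrite (le_lt_trans (ler_normD _ _))// ltrD// distrC.
have Tp : graph T p.
  apply: closedT.2; apply/closure_normP => e /Bp[_ [a Aa [-> _]]].
  by exists (a, T a) => //; split => //; exact: opdom_bracket_square Aa.
(* As [Q] is onto, it suffices to test against [Q y]; symmetry moves [Q] onto [a - x], and [Q a] is
   close to [Q x]. *)
have px : p.1 = x.
  apply/eqP; rewrite -subr_eq0; apply/eqP; apply: eq0_innerl => h.
  have [y Qy <-] := surjQ h; apply/eqP; rewrite -normr_eq0; apply/eqP.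
  apply: (@eq0_le_small _ _ (`|Q y| + `|y|)) => // e e0.
  have [_ [a Aa [-> ae]] pe] := Bp _ e0.
  have [Qa _] := QQA _ Aa.
  rewrite -(subrKA a) innerDl mulrDr (le_trans (ler_normD _ _))// lerD//.
    rewrite (le_trans (cauchy_schwarz _ _))// ler_wpM2r//.
    by rewrite (le_trans _ (ltW pe))//; exact: norm_fst_le (p - (a, T a)).
  rewrite innerBl -!symQ// -innerBl (le_trans (cauchy_schwarz _ _))//.
  by rewrite ler_wpM2r// distrC ltW.
have pQ : `|p| <= `|Q x|.
  apply/ler_addgt0Pr => e e0.
  have e20 : 0 < e / 2 by rewrite divr_gt0.
  have [_ [a Aa [-> ae]] pe] := Bp _ e20.
  have Qae : `|Q a| <= e / 2 + `|Q x|.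
    rewrite -[Q a](subrK (Q x)) (le_trans (ler_normD _ _))// lerD2r.
    by rewrite distrC ltW.
  rewrite -(subrK (a, T a) p) (le_trans (ler_normD _ _))// normQ//.
  by rewrite (le_trans (lerD (ltW pe) Qae))// addrA -splitr addrC.
move: Tp px pQ; clear Bp; case: p => p1 p2 [/= Tx ->] px; rewrite px in Tx *.
by rewrite -(@ler_pXn2r _ 2) ?nnegrE// sqr_norm_dsum.
Qed.

Lemma bracket_like_bracket : bracket_like T (bracket T).
Proof.
rewrite /bracket /op_sqrt; case: pselect => [ex|_].
  by case: cid => Q /= /bracket_like_sqrt.
exact: bracket_like_square.
Qed.

End BracketLike.

(** * Inverse operators, and the bounded column operator [J T] with its adjoint *)

Lemma op_invP (R : realType) (H1 H2 : hilbertType R) (A : operator H1 H2) y :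
  opdom (op_inv A) y -> opdom A (op_inv A y) /\ A (op_inv A y) = y.
Proof.
case=> x Ax xy; pose P := [set z | opdom A z /\ A z = y].
by apply: (@getPex _ P); exists x.
Qed.

(* A bound in [bounded_linear] may be non-real if the domain is trivial. *)
Lemma bounded_linear_gt0 (R : realType) (V W : normedModType (C R))
    (f : V -> W) :
  bounded_linear f -> exists2 M : C R, 0 < M & forall x, `|f x| <= M * `|x|.
Proof.
move=> [_ [M fM]]; exists (`|M| + 1) => [|x]; first by rewrite ltr_wpDl.
have Mx0 : 0 <= M * `|x| by apply: le_trans (fM x).
rewrite (le_trans (fM x))// -[leLHS]ger0_norm// normrM normr_id.
by rewrite ler_wpM2r// lerDl.
Qed.

Section J.
Context (R : realType) (H1 H2 : hilbertType R) (T : operator H1 H2).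
Context (closedT : closed_operator T) (denseT : densely_defined T).

Local Notation A := (op_add (op_id H1) (op_comp (adjoint T) T)).
Local Notation Q := (bracket T).

Let linT : linear_operator T := closedT.1.

Let bracketP := bracket_like_bracket closedT denseT.

Lemma opdom_bracket_inv : opdom (op_inv Q) = setT.
Proof.
rewrite -subTset => y _; have [_ _ surjQ _] := bracketP.
by have [x Qx xy] := surjQ y; exists x.
Qed.

Lemma bracket_invK y : opdom Q (op_inv Q y) /\ Q (op_inv Q y) = y.
Proof. by apply: op_invP; rewrite opdom_bracket_inv. Qed.

Lemma opdom_bracket x : opdom Q x -> opdom T x.
Proof. by move=> Qx; have [_ _ _ /(_ x Qx)[]] := bracketP. Qed.

Lemma bracket_inj x y : opdom Q x -> opdom Q y -> Q x = Q y -> x = y.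
Proof.
have [linQ _ _ normQ] := bracketP; move=> Qx Qy xy.
apply/eqP; rewrite -subr_eq0; apply/eqP; apply: sqr_normr_eq0.
have [_] := normQ _ (subspaceB (subspace_opdom linQ) Qx Qy).
rewrite (linear_operatorB linQ)// xy subrr normr0 expr0n/=.
move=> xy0; apply/eqP; rewrite eq_le exprn_ge0// andbT (le_trans _ xy0)//.
by rewrite lerDl exprn_ge0.
Qed.

Lemma opdom_J : opdom (J T) = setT.
Proof.
rewrite -subTset => y _.
have domB : opdom (op_inv Q) y by rewrite opdom_bracket_inv.
by do 2!split => //; apply: opdom_bracket; have [] := bracket_invK y.
Qed.

Lemma graph_J y : graph T (J T y).
Proof. by split => //; apply: opdom_bracket; case: (bracket_invK y). Qed.

Lemma norm_J_le y : `|J T y| <= `|y|.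
Proof.
have [Qy yE] := bracket_invK y; have [_ _ _ normQ] := bracketP.
rewrite -(@ler_pXn2r _ 2) ?nnegrE// sqr_norm_dsum -{3}yE.
by have [] := normQ _ Qy.
Qed.

Lemma linear_bracket_inv : linear (op_inv Q).
Proof.
move=> a x y; have [linQ _ _ _] := bracketP.
have [[Qx xE] [Qy yE]] := (bracket_invK x, bracket_invK y).
have [Qxy xyE] := bracket_invK (a *: x + y).
apply: bracket_inj => //; first exact: (subspace_opdom linQ).2.
by rewrite (linear_operatorP linQ)// xyE xE yE.
Qed.

Lemma linear_J : linear (J T).
Proof.
move=> a x y; have [[Qx _] [Qy _]] := (bracket_invK x, bracket_invK y).
rewrite [LHS](_ : _ = (op_inv Q (a *: x + y), T (op_inv Q (a *: x + y))))//.
by rewrite linear_bracket_inv (linear_operatorP linT)//; exact: opdom_bracket.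
Qed.

Lemma J_core x : opdom A x -> exists y, J T y = (x, T x).
Proof.
move=> Ax; have [_ AQ _ _] := bracketP; exists (Q x).
have [Qx xE] := bracket_invK (Q x).
have := bracket_inj Qx (AQ _ Ax) xE => {}xE.
by rewrite -[in RHS]xE.
Qed.

(** Riesz representation of the bounded functional sending [x] to [inner (J T x) p]. *)
Lemma adjoint_J p : opdom (adjoint (J T)) p.
Proof.
have [||//|w wP] := @riesz _ H1 (fun x => inner (J T x) p) `|p|.
- by move=> a x y; rewrite linear_J innerDl innerZl.
- move=> x; rewrite (le_trans (cauchy_schwarz _ _))// mulrC ler_wpM2l//.
  exact: norm_J_le.
by exists w => x _; rewrite wP.
Qed.

Lemma inner_J x p : inner (J T x) p = inner x (adjoint (J T) p).
Proof. by apply: adjointP; rewrite ?opdom_J//; exact: adjoint_J. Qed.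

(** For [w := adjoint (J T) p], one has [|w| ^+ 2 = inner (J T w) p], and [J T] is a contraction. *)
Lemma norm_adjoint_J_le p : `|adjoint (J T) p| <= `|p|.
Proof.
set w := adjoint _ p; have [->|w0] := eqVneq w 0; first by rewrite normr0.
rewrite -(@ler_pM2r _ `|w|) ?normr_gt0// -expr2.
rewrite -[X in X <= _]ger0_norm ?exprn_ge0// sqr_normr -inner_J.
rewrite (le_trans (cauchy_schwarz _ _))// mulrC ler_wpM2l//.
exact: norm_J_le.
Qed.

(* The range of [J T] contains a core of [T], and it is closed if [J T] is
   bounded below. *)
Lemma J_surj (c : C R) : 0 < c -> (forall x, `|x| <= c * `|J T x|) ->
  forall p, graph T p -> exists x, J T x = p.
Proof.
move=> c0 Jc.
have JB x y : J T x - J T y = J T (x - y).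
  by rewrite -[in RHS]scaleN1r addrC -[in RHS]addrC linear_J scaleN1r addrC.
pose S := range (J T).
have Ssub : linear_subspace S.
  split; first by exists 0 => //; rewrite -(subrr (0 : H1)) -JB subrr.
  by move=> a _ _ [x _ <-] [y _ <-]; exists (a *: x + y); rewrite ?linear_J.
have Scl : closed S.
  move=> p /closure_normP Sp.
  have [e /Sp[_ [x _ <-] xe]|e e' ee' x /= xe|e e0|x Bx] :=
    @complete_approx _ _ (fun e => [set x | `|p - J T x| < e]).
  - by exists x.
  - exact: lt_le_trans ee'.
  (* When [J T x] and [J T y] are both within [e / c / 2] of [p], the lower bound on [J T] gives
     [|x - y| < e]. *)
  - have ec : 0 < e / c / 2 by rewrite !divr_gt0.
    exists (e / c / 2) => // x y /= xe ye.
    rewrite (le_lt_trans (Jc _))// -ltr_pdivlMl// mulrC -JB [ltRHS]splitr.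
    rewrite -(subrKA p) (le_lt_trans (ler_normD _ _))// ltrD//.
    by rewrite distrC.
  exists x => //; apply/esym/eqP; rewrite -subr_eq0 -normr_eq0; apply/eqP.
  apply: (@eq0_le_small _ _ (1 + 1)) => // e e0.
  have [y ye xy] := Bx _ e0.
  rewrite -(subrKA (J T y)) (le_trans (ler_normD _ _))// mulrDr mulr1.
  rewrite lerD ?ltW//.
  by rewrite JB (le_lt_trans (norm_J_le _))// distrC.
(* The residual [p - J T x] lies in the graph and is orthogonal to the range of [J T], hence to the
   core. *)
move=> p Tp; have [_ [x _ <-] pS] := projection p Ssub Scl.
exists x; apply/esym/eqP; rewrite -subr_eq0; apply/eqP.
apply: (bracket_square_core closedT denseT).
  by apply: subspaceB => //; [exact: subspace_graph|exact: graph_J].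
by move=> y /J_core[z <-]; apply: pS; exists z.
Qed.

End J.

(** * Differentiable parametrisation of the graphs *)

Unset Implicit Arguments.

Theorem proposition4p8 (R : realType) (H1 H2 : hilbertType R)
    (Theta : set (C R)) (openTheta : open Theta)
    (T : C R -> operator H1 H2)
    (closedT : forall z, Theta z -> closed_operator (T z))
    (denseT : forall z, Theta z -> densely_defined (T z))
    (z0 : C R) (Thetaz0 : Theta z0) :
  (exists Theta0 : set (C R),
    [/\ open Theta0, Theta0 z0, Theta0 `<=` Theta,
        forall z, Theta0 z -> op_invertible (JJ (T z0) (T z)) &
        norm_differentiable_at (fun z => charmx (T z) (T z0)) z0]) ->
  complex_differentiable_at Theta T z0.
Proof.
move=> [Th0 [open0 Th0z0 Th0Theta inv0 [D bD diffD]]].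
have cT0 := closedT _ Thetaz0; have dT0 := denseT _ Thetaz0.
pose inv z := op_inv (JJ (T z0) (T z)).
pose Rz z x := J (T z) (inv z x).
have domJJ z : Theta z -> opdom (JJ (T z0) (T z)) = setT.
  move=> Tz; rewrite -subTset => x _; split.
    by rewrite (opdom_J (closedT _ Tz) (denseT _ Tz)).
  exact: adjoint_J.
have invK z x : Th0 z -> JJ (T z0) (T z) (inv z x) = x.
  move=> /inv0[_ [dom _]].
  by have [|_ ->] := @op_invP _ _ _ (JJ (T z0) (T z)) x; rewrite ?dom.
have JJ_inj z : Th0 z -> injective (JJ (T z0) (T z)).
  move=> Tz x y xy; have [[_ inj _] _] := inv0 _ Tz.
  by apply: inj => //; rewrite inE domJJ//; exact: Th0Theta.
have inv_bound z : Th0 z ->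
    exists2 c : C R, 0 < c & forall x, `|inv z x| <= c * `|x|.
  by move=> /inv0[_ [_ /bounded_linear_gt0]].
have Rz_bound : exists2 c : C R, 0 <= c & forall x, `|Rz z0 x| <= c * `|x|.
  have [c c0 cP] := inv_bound _ Th0z0; exists c; first exact: ltW.
  by move=> x; rewrite (le_trans (norm_J_le cT0 dT0 _)).
pose charR z x := charmx (T z) (T z0) (Rz z0 x).
(* This holds for every [z], also outside [Th0]: after unfolding, only the cancellation of
   [JJ (T z0) (T z0)] with its inverse at [z0] is involved. *)
have charRE : charR = Rz.
  by apply/funext => z; apply/funext => x; rewrite /Rz -{2}(invK _ x Th0z0).
exists Th0; split => //; exists H1, Rz; split.
  move=> z Tz; have Tz' := Th0Theta _ Tz.
  have [cT dT] := (closedT _ Tz', denseT _ Tz').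
  have [_ [_ [lininv _]]] := inv0 _ Tz.
  have [c c0 cP] := inv_bound _ Tz.
  have Rinj : injective (Rz z).
    move=> x y; rewrite /Rz => /(congr1 (adjoint (J (T z0)))).
    by move=> xy; rewrite -(invK z x Tz) -(invK z y Tz).
  (* [x] is recovered by applying [inv z] to [adjoint (J (T z0)) (J (T z) x)], and the adjoint is a
     contraction. *)
  have Jc x : `|x| <= c * `|J (T z) x|.
    have invJ : inv z (JJ (T z0) (T z) x) = x.
      by apply: (JJ_inj _ Tz); rewrite invK.
    rewrite -{1}invJ (le_trans (cP _))// ler_wpM2l ?(ltW c0)//.
    exact: norm_adjoint_J_le.
  have Rsurj p : graph (T z) p -> exists x, Rz z x = p.
    move=> /(J_surj cT dT c0 Jc)[y <-]; exists (JJ (T z0) (T z) y).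
    by congr (J _ _); apply: (JJ_inj _ Tz); rewrite invK.
  have rangeR : range (Rz z) = graph (T z).
    apply/seteqP; split => [_ [x _ <-]|p /Rsurj[x <-]]; last by exists x.
    exact: graph_J.
  split => //.
  - split; first by move=> a x y; rewrite /Rz lininv linear_J.
    by exists c => x; rewrite (le_trans (norm_J_le _ _ _)).
  - by rewrite rangeR; have [] := cT.
  - split => [x _|x y _ _ /Rinj//|p /Rsurj[x <-]]; last by exists x.
    exact: graph_J.
rewrite -[X in norm_differentiable_at X]charRE; have [c c0 cP] := Rz_bound.
have [_ [_ [lininv _]]] := inv0 _ Th0z0.
have [N N0 DN] := bounded_linear_gt0 bD; have [linD _] := bD.
(* The right factor [Rz z0] does not depend on [z], so the derivative is [D] composed with it. *)
exists (fun x => D (Rz z0 x)).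
  split; first by move=> a x y; rewrite /Rz lininv linear_J// linD.
  exists (N * c) => x.
  by rewrite (le_trans (DN _))// -mulrA ler_wpM2l// ltW.
move=> e e0.
(* [c] is only known to be nonnegative, so the tolerance asked of the characteristic matrix is
   [e / (c + 1)]. *)
have c1 : 0 < c + 1 by rewrite ltr_wpDl.
have := diffD _ (divr_gt0 e0 c1); apply: filterS => z zP x.
rewrite (le_trans (zP (Rz z0 x)))//.
rewrite mulrAC ler_pdivrMr// -mulrA ler_wpM2l ?(ltW e0)//.
by rewrite (le_trans (cP _))// mulrC ler_wpM2l// lerDl.
Qed.
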